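(* Let $\mathbb{K}$ be a field of characteristic zero and $m\ge 1$. Any (generalized) oscillator $\mathbb{K}$-algebra of dimension $2m+2$ can be obtained as a split extension of a Lie algebra of Heisenberg type $\mathfrak{h}_{2m+1}$ by a map $d\in\operatorname{Der}\mathfrak{h}_{2m+1}$ such that $\mathfrak{h}_{2m+1}=\operatorname{Im}d\oplus\ker d$, where $\ker d=Z(\mathfrak{h}_{2m+1})$ and the invariant vector space $\operatorname{Im}d$ is endowed with a symmetric and nondegenerate bilinear form $\varphi$ for which $d|_{\operatorname{Im}d}$ is $\varphi$-skew. Moreover, a linear map $D:\mathfrak{d}(V_{2m},\varphi,\delta)\to\mathfrak{d}(V_{2m},\varphi,\delta)$ of the oscillator $\mathbb{K}$-algebra $\mathfrak{d}(V_{2m},\varphi,\delta)$ is a derivation if and only if: (a) the nilradical $\mathfrak{n}(\mathfrak{d}(V_{2m},\varphi,\delta))=V_{2m}\oplus\mathbb{K}\cdot\delta^*$, which is a Lie algebra of Heisenberg type $\mathfrak{h}_{2m+1}$, is $D$-invariant and $D|_{\mathfrak{n}(\mathfrak{d}(V_{2m},\varphi,\delta))}\in\operatorname{Der}\mathfrak{h}_{2m+1}$; (b) $D(\delta^* )=\alpha\delta^*$ for some $\alpha\in\mathbb{K}$; (c) $D(\delta(a))=[D(\delta),a]+[\delta,D(a)]$ for all $a\in V_{2m}$.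
   Context: Let $(V_{2m},\varphi)$ be a $2m$-dimensional $\mathbb{K}$-vector space with a symmetric nondegenerate bilinear form $\varphi$. A linear map $f$ of a space with bilinear form $\varphi$ is $\varphi$-skew if $\varphi(f(u),v)+\varphi(u,f(v))=0$ for all $u,v$. Let $\delta$ be a $\varphi$-skew linear automorphism of $V_{2m}$. The (generalized) oscillator $\mathbb{K}$-algebra $\mathfrak{d}(V_{2m},\varphi,\delta)$ is the vector space $\mathbb{K}\cdot\delta\oplus V_{2m}\oplus\mathbb{K}\cdot\delta^*$ (with $\delta$ and its dual $1$-form $\delta^*$ viewed as basis vectors) with Lie bracket $$[t\delta+u+s\delta^*,\,t'\delta+v+s'\delta^*]=t\,\delta(v)-t'\,\delta(u)+\varphi(\delta(u),v)\,\delta^*.$$ In particular $[\delta,a]=\delta(a)$ for $a\in V_{2m}$; in (c), $D(\delta)$ is the image under $D$ of the basis vector $\delta$. A Lie algebra of Heisenberg type is a Lie algebra whose centre is one-dimensional and equal to its derived algebra; $\mathfrak{h}_{2m+1}$ denotes the (unique up to isomorphism) such algebra of dimension $2m+1$. $\operatorname{Der}$ denotes the Lie algebra of derivations, $Z$ the centre, and $\mathfrak{n}(\mathfrak{g})$ the nilradical (maximal nilpotent ideal) of $\mathfrak{g}$. The split extension of $\mathfrak{h}_{2m+1}$ by $d\in\operatorname{Der}\mathfrak{h}_{2m+1}$ is the semidirect product $\mathbb{K}\cdot d\oplus\mathfrak{h}_{2m+1}$, in which $\mathfrak{h}_{2m+1}$ is an ideal with its own bracket and $[d,x]=d(x)$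 for $x\in\mathfrak{h}_{2m+1}$. *)

(* Defs.v *)
From HB Require Import structures.
From mathcomp Require Import all_boot all_order all_algebra.
From mathcomp Require Import ring.

Set Implicit Arguments.
Unset Strict Implicit.
Unset Printing Implicit Defensive.

Import GRing.Theory.
Local Open Scope ring_scope.

HB.mixin Record isLieAlgebra (K : fieldType) L of Vector K L := {
  lie : L -> L -> L;
  lie_is_bilinear : bilinear_for *:%R *:%R lie;
  lie_alt : forall x : L, lie x x = 0;
  lie_jacobi : forall x y z : L,
    lie x (lie y z) + lie y (lie z x) + lie z (lie x y) = 0
}.

#[short(type="lieAlgType")]
HB.structure Definition LieAlgebra (K : fieldType) :=
  {L of isLieAlgebra K L & Vector K L}.

Notation "[lie x , y ]" := (lie x y)
  (at level 0, x, y at level 99, format "[lie  x ,  y ]") : ring_scope.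

HB.instance Definition _ (K : fieldType) (L : lieAlgType K) :=
  bilinear_isBilinear.Build K L L L *:%R *:%R (@lie K L) lie_is_bilinear.

Lemma coord_inj (K : fieldType) (V : vectType K) (x y : V) :
  (forall i, coord (vbasis fullv) i x = coord (vbasis fullv) i y) -> x = y.
Proof.
move=> exy; rewrite (coord_vbasis (memvf x)) (coord_vbasis (memvf y)).
by apply: eq_bigr => i _; rewrite exy.
Qed.

Section LieTheory.
Variables (K : fieldType) (L : lieAlgType K).
Implicit Types (x y z : L) (U W I N X : {vspace L}) (D : 'End(L)).

Lemma lieC x y : [lie x, y] = - [lie y, x].
Proof.
apply/eqP; rewrite -addr_eq0; apply/eqP.
have := lie_alt (x + y).
by rewrite linearDl /= !linearDr /= !lie_alt add0r addr0.
Qed.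

(* The linear span of all brackets [u, w] with u in U and w in W; by
   bilinearity it is enough to bracket basis vectors, see lie_prodP. *)
Definition lie_prod U W : {vspace L} :=
  <<[seq [lie u, w] | u <- vbasis U, w <- vbasis W]>>%VS.

Lemma lie_prodP U W X :
  reflect {in U & W, forall u w, [lie u, w] \in X} (lie_prod U W <= X)%VS.
Proof.
apply: (iffP span_subvP) => [sX u w | inX _ /allpairsP[[u w] /= [Uu Ww ->]]].
  move=> /coord_vbasis-> /coord_vbasis->.
  rewrite linear_sumlz rpred_sum // => i _.
  rewrite linear_sumr rpred_sum // => j _.
  rewrite linearZl_LR linearZr_LR /= !rpredZ // sX //.
  by apply: allpairs_f; rewrite mem_nth ?size_tuple.
by apply: inX; apply: vbasis_mem.
Qed.

Definition lie_subalgebra U := (lie_prod U U <= U)%VS.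

Definition lie_ideal I := (lie_prod fullv I <= I)%VS.

Definition derived_algebra U := lie_prod U U.

Definition ad x : 'End(L) := linfun (lie x).

Lemma adE x y : ad x y = [lie x, y].
Proof.
have lin : linear (lie x) := lie_is_bilinear.2 x.
pose f : {linear L -> L} :=
  HB.pack (lie x : L -> L) (GRing.isLinear.Build K L L *:%R (lie x) lin).
exact: (lfunE f).
Qed.

(* The centre of the Lie subalgebra U (not its centralizer in L), as the
   vectors of U that commute with a basis of U, see lie_centerP. *)
Definition lie_center U : {vspace L} :=
  (U :&: \bigcap_(u <- vbasis U) lker (ad u))%VS.

Lemma lie_centerP U x :
  reflect (x \in U /\ {in U, forall u, [lie u, x] = 0}) (x \in lie_center U).
Proof.
rewrite memv_cap; apply: (iffP andP) => -[xU cx]; split=> //.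
  move=> u Uu; have cxb b : b \in vbasis U -> [lie b, x] = 0.
    move=> Ub; apply/eqP; move: cx.
    by rewrite (big_rem b) //= memv_cap memv_ker adE => /andP[].
  rewrite (coord_vbasis Uu) linear_sumlz big1 // => i _.
  by rewrite linearZl_LR /= cxb ?scaler0 // mem_nth ?size_tuple.
rewrite big_seq; elim/big_ind: _ => [|A B xA xB|u /vbasis_mem Uu].
- exact: memvf.
- by rewrite memv_cap xA.
- by rewrite memv_ker adE /= cx.
Qed.

Fixpoint lower_central U n : {vspace L} :=
  if n is n'.+1 then lie_prod U (lower_central U n') else U.

Definition lie_nilpotent U := exists n, lower_central U n = 0%VS.

Definition is_nilradical N :=
  [/\ lie_ideal N, lie_nilpotent N &
      forall I, lie_ideal I -> lie_nilpotent I -> (I <= N)%VS].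

Definition heisenberg_type U :=
  [/\ lie_subalgebra U, \dim (lie_center U) = 1%N &
      lie_center U = derived_algebra U].

Definition derivation D :=
  forall x y, D [lie x, y] = [lie D x, y] + [lie x, D y].

(* D maps U to itself and its restriction to U is a derivation of U. *)
Definition derivation_on U D :=
  (D @: U <= U)%VS /\
  {in U &, forall x y, D [lie x, y] = [lie D x, y] + [lie x, D y]}.

End LieTheory.

Definition lie_isomorphic (K : fieldType) (L L' : lieAlgType K) :=
  exists2 f : 'Hom(L, L'), bijective f &
    forall x y, f [lie x, y] = [lie f x, f y].

(* A condition on the map f; is_skew is a condition on the form. *)
Definition form_skew (K : fieldType) (V : vectType K) (phi : {symmetric V})
    (f : V -> V) :=
  forall u v, phi (f u) v + phi u (f v) = 0.

(* The restriction of f to U, meaningful when f maps U to itself. *)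
Definition restr (K : fieldType) (V : vectType K) (f : 'End(V))
    (U : {vspace V}) (u : subvs_of U) : subvs_of U := vsproj U (f (vsval u)).

(* (t, u, s) stands for t delta + u + s delta^*. The parameters charK and
   skew make this type carry its Lie algebra structure. *)
Definition oscillator (K : fieldType) (charK : [pchar K] =i pred0)
    (V : vectType K) (phi : {symmetric V}) (delta : 'End(V))
    (skew : form_skew phi delta) : Type := (K^o * V * K^o)%type.

Section Oscillator.
Variables (K : fieldType) (charK : [pchar K] =i pred0).
Variables (V : vectType K) (phi : {symmetric V}) (delta : 'End(V)).
Variable skew : form_skew phi delta.

Local Notation osc := (oscillator charK skew).

HB.instance Definition _ := Vector.copy osc (K^o * V * K^o)%type.

Definition osc_lie (x y : osc) : osc :=
  (0, x.1.1 *: delta y.1.2 - y.1.1 *: delta x.1.2, phi (delta x.1.2) y.1.2).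

Lemma osc_lie_bilinear : bilinear_for *:%R *:%R osc_lie.
Proof.
split=> [[[t' v] s'] a [[t1 u1] s1] [[t2 u2] s2]
       | [[t u] s] a [[t1 v1] s1] [[t2 v2] s2]]; rewrite /osc_lie /=.
- congr (_, _, _); rewrite /= ?scaler0 ?addr0 //.
    rewrite linearP /= scalerDl scalerDr scalerBr !scalerA opprD addrACA.
    by rewrite [t' * a]mulrC.
  by rewrite linearP linearPl.
- congr (_, _, _); rewrite /= ?scaler0 ?addr0 //.
    rewrite linearP /= scalerDl scalerDr scalerBr !scalerA opprD addrACA.
    by rewrite [t * a]mulrC.
  by rewrite linearPr.
Qed.

Lemma form_symm u v : phi u v = phi v u.
Proof. by rewrite hermC expr0 mul1r. Qed.

Lemma osc_lie_alt x : osc_lie x x = 0.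
Proof.
case: x => [[t u] s]; congr (_, _, _) => /=; first by rewrite subrr.
have /eqP := skew u u; rewrite [phi u _]form_symm -mulr2n -mulr_natl mulf_eq0.
by rewrite ((pcharf0P K).1 charK) => /eqP.
Qed.

Lemma osc_lie_jacobi x y z :
  osc_lie x (osc_lie y z) + osc_lie y (osc_lie z x)
    + osc_lie z (osc_lie x y) = 0.
Proof.
case: x y z => [[t u] s] [[t' v] s'] [[t'' w] s'']; rewrite /osc_lie /=.
congr (_, _, _) => /=; first by rewrite !addr0.
  rewrite !scale0r !subr0 !linearB !linearZ /=.
  apply: coord_inj => i; rewrite !(linearD, linearN, linearZ, linear0) /=; ring.
rewrite !linearB /= !linearZ /= [phi (delta v) (delta u)]form_symm.
rewrite [phi (delta w) (delta u)]form_symm [phi (delta w) (delta v)]form_symm.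
ring.
Qed.

HB.instance Definition _ :=
  isLieAlgebra.Build K osc osc_lie_bilinear osc_lie_alt osc_lie_jacobi.

Definition osc_delta : osc := (1, 0, 0).
Definition osc_dual : osc := (0, 0, 1).
Definition osc_vec (v : V) : osc := (0, v, 0).

Lemma osc_vec_linear : linear osc_vec.
Proof. by move=> a u v; congr (_, _, _); rewrite /= scaler0 addr0. Qed.

HB.instance Definition _ :=
  GRing.isLinear.Build K V osc *:%R osc_vec osc_vec_linear.

(* V (+) K delta^* *)
Definition osc_heis : {vspace osc} :=
  (limg (linfun osc_vec) + <[osc_dual]>)%VS.

End Oscillator.

(* K d (+) h, where (t, x) stands for t d + x. *)
Definition split_ext (K : fieldType) (h : lieAlgType K) (d : 'End(h))
    (derd : derivation d) : Type := (K^o * h)%type.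

Section SplitExt.
Variables (K : fieldType) (h : lieAlgType K) (d : 'End(h)).
Variable derd : derivation d.

Local Notation ext := (split_ext derd).

HB.instance Definition _ := Vector.copy ext (K^o * h)%type.

Definition ext_lie (x y : ext) : ext :=
  (0, x.1 *: d y.2 - y.1 *: d x.2 + [lie x.2, y.2]).

Lemma ext_lie_bilinear : bilinear_for *:%R *:%R ext_lie.
Proof.
split=> [[s y] a [t1 x1] [t2 x2] | [t x] a [s1 y1] [s2 y2]];
  congr (_, _); rewrite /= ?scaler0 ?addr0 //.
- rewrite linearP linearPl /=; apply: coord_inj => i.
  by rewrite !(linearD, linearN, linearZ) /= -[a *: t1]/(a * t1); ring.
- rewrite linearP linearPr /=; apply: coord_inj => i.
  by rewrite !(linearD, linearN, linearZ) /= -[a *: s1]/(a * s1); ring.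
Qed.

Lemma ext_lie_alt x : ext_lie x x = 0.
Proof. by congr (_, _); rewrite /= lie_alt subrr addr0. Qed.

Lemma ext_lie_jacobi x y z :
  ext_lie x (ext_lie y z) + ext_lie y (ext_lie z x)
    + ext_lie z (ext_lie x y) = 0.
Proof.
case: x y z => [r x] [s y] [t z]; congr (_, _); first by rewrite /= !addr0.
rewrite /= !scale0r !subr0 !linearDr /= !linearNr /= !linearZr_LR /=.
rewrite !linearD /= !linearN /= !linearZ /= !derd.
rewrite [[lie d z, x]]lieC [[lie d x, y]]lieC [[lie d y, z]]lieC.
have -> : [lie z, [lie x, y]] = - ([lie x, [lie y, z]] + [lie y, [lie z, x]]).
  by apply/eqP; rewrite eq_sym eqr_oppLR -addr_eq0 lie_jacobi.
apply: coord_inj => i; rewrite !(linearD, linearN, linearZ, linear0) /=; ring.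
Qed.

HB.instance Definition _ :=
  isLieAlgebra.Build K ext ext_lie_bilinear ext_lie_alt ext_lie_jacobi.

End SplitExt.

(* Main.v *)
Require Import Defs.
From mathcomp Require Import all_boot all_order all_algebra.
From HB Require Import structures.
From mathcomp Require Import ring.

Import GRing.Theory.
Local Open Scope ring_scope.

Set Implicit Arguments.
Unset Strict Implicit.
Unset Printing Implicit Defensive.

(** Write x = t delta + u + s delta^* for an element of the oscillator
    algebra g. Everything rests on two remarks. Brackets have no
    delta-component, so n, the hyperplane t = 0, is an ideal containing [g, g].
    Inside n the bracket is (u, v) |-> phi (delta u, v) delta^*, and this
    2-form omega is alternating, because delta is skew and the characteristic is
    not 2, and nondegenerate, because delta is onto and phi is nondegenerate.
    Hence the centre of n is the line of delta^*; as dim n > 1, the derived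
    algebra of n cannot vanish and equals that line
    ([heisenberg_of_central_line], [heisenberg_osc_heis]).

    Nilradical ([osc_heis_nilradical]): n is nilpotent, being of Heisenberg
    type. An ideal I having an element x with t <> 0 is not nilpotent: modulo
    delta^*, ad x acts on V as t delta, which is onto, so every term of the
    lower central series of I still projects onto V, which is not zero
    ([lower_central_osc]).

    Split extension ([osc_split_ext]): take for h the Heisenberg algebra of
    omega on the space V (+) K, and d = delta (+) 0. Skewness of delta says that
    omega (delta u, v) + omega (u, delta v) = 0, that is, d is a derivation. Its
    image is V and its kernel is K, the centre of h; the form on the image is
    phi itself, and the isomorphism reorders the components.

    Derivations ([osc_derivationP]): a derivation preserves n, which equals
    [g, g] because delta is onto ([osc_heisE]), hence also [n, n], the line of
    delta^*; this gives (a) and (b), and (c) is the derivation rule at the pair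
    (delta, a). Conversely, g is spanned by delta and n and the bracket is
    alternating, so the rule has to be checked on pairs in n, which is (a), and
    on pairs (delta, z) with z in n. The latter is (c) for z in V; for
    z = delta^* both sides vanish by (b), since delta^* is central. *)

(** * Generalities on Lie algebras and forms *)

Lemma nondegenerateP (K : fieldType) (V : vectType K) (phi : {symmetric V}) :
  reflect (forall u, (forall v, phi u v = 0) -> u = 0) (nondegenerate phi).
Proof.
apply: (iffP eqP) => [rad0 u phiu0 | phi_inj].
  by apply/eqP; rewrite -memv0 -rad0; apply/mem_orthovP => v _.
apply/eqP; rewrite -subv0; apply/subvP => u /mem_orthovP phiu0.
by rewrite memv0; apply/eqP/phi_inj => v; apply: phiu0; rewrite memvf.
Qed.

Lemma form_skewE (K : fieldType) (V : vectType K) (phi : {symmetric V})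
    (f : V -> V) (skew : form_skew phi f) u v : phi (f u) v = - phi u (f v).
Proof. by apply/eqP; rewrite -addr_eq0 skew. Qed.

Section LieGeneral.
Variables (K : fieldType) (L : lieAlgType K).
Implicit Types (x y z : L) (U W : {vspace L}).

Lemma mem_lie_prod U W x y : x \in U -> y \in W -> [lie x, y] \in lie_prod U W.
Proof. by have /lie_prodP := subvv (lie_prod U W); apply. Qed.

Lemma derivation_lie_prod (D : 'End(L)) U W :
    derivation D -> (D @: U <= U)%VS -> (D @: W <= W)%VS ->
  (D @: lie_prod U W <= lie_prod U W)%VS.
Proof.
move=> derD sU sW; rewrite limg_span; apply/span_subvP => _ /mapP[x xUW ->].
have{x xUW}/allpairsP[[u w] /= [/vbasis_mem Uu /vbasis_mem Ww ->]] := xUW.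
rewrite derD rpredD // mem_lie_prod //; apply: subvP; first exact: sU.
  exact: memv_img.
  exact: sW.
exact: memv_img.
Qed.

(** The derived algebra is contained in the line of [z] and is not zero, for
    otherwise [U] would be equal to its centre, of dimension 1. *)
Lemma heisenberg_of_central_line U z :
    (1 < \dim U)%N -> z != 0 -> lie_center U = <[z]>%VS ->
    {in U &, forall x y, [lie x, y] \in <[z]>%VS} ->
  heisenberg_type U.
Proof.
move=> dimU z0 Z bz.
have sUz : (derived_algebra U <= <[z]>)%VS by apply/lie_prodP.
have zU : (<[z]> <= U)%VS by rewrite -Z capvSl.
split; rewrite ?Z ?dim_vline ?z0 //; first exact: subv_trans sUz zU.
apply/esym/eqP; rewrite -(dimv_leqif_eq sUz).2 dim_vline z0 /=.
rewrite eqn_leq; have := dimvS sUz; rewrite dim_vline z0 => -> /=.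
rewrite lt0n dimv_eq0; apply: contraL dimU => /eqP D0; rewrite -leqNgt.
suff /dimvS : (U <= <[z]>)%VS by rewrite dim_vline z0.
rewrite -Z; apply/subvP => x Ux; apply/lie_centerP; split=> // u Uu.
by apply/eqP; rewrite -memv0 -D0 mem_lie_prod.
Qed.

(** The derived algebra is central, so triple brackets vanish. *)
Lemma heisenberg_nilpotent U : heisenberg_type U -> lie_nilpotent U.
Proof.
case=> _ _ Z; exists 2; apply/eqP; rewrite -subv0 /=; apply/lie_prodP => u w Uu.
by rewrite -/(derived_algebra U) -Z memv0 => /lie_centerP[_ ->].
Qed.

End LieGeneral.

(** * The Heisenberg algebra of an alternating form *)

(** Pairs [(u, s)] stand for [u + s z], where [z] is central. The parameter
    [omega_alt] makes this type carry its Lie algebra structure. *)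
Definition heis (K : fieldType) (V : vectType K) (omega : {biscalar V})
    (omega_alt : forall u, omega u u = 0) : Type := (V * K^o)%type.

Section Heis.
Variables (K : fieldType) (V : vectType K) (omega : {biscalar V}).
Variable omega_alt : forall u, omega u u = 0.

Local Notation heis := (heis omega_alt).

HB.instance Definition _ := Vector.copy heis (V * K^o)%type.

Definition heis_lie (x y : heis) : heis := (0, omega x.1 y.1).

Lemma heis_lie_bilinear : bilinear_for *:%R *:%R heis_lie.
Proof.
split=> [y a x1 x2 | x a y1 y2]; congr (_, _); rewrite /= ?scaler0 ?addr0 //.
  by rewrite linearPl.
by rewrite linearPr.
Qed.

Lemma heis_lie_alt x : heis_lie x x = 0.
Proof. by congr (_, _); apply: omega_alt. Qed.

Lemma heis_lie_jacobi x y z :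
  heis_lie x (heis_lie y z) + heis_lie y (heis_lie z x)
    + heis_lie z (heis_lie x y) = 0.
Proof. by congr (_, _); rewrite /= ?linear0r !addr0. Qed.

HB.instance Definition _ :=
  isLieAlgebra.Build K heis heis_lie_bilinear heis_lie_alt heis_lie_jacobi.

Definition heis_central : heis := (0, 1).

Lemma heis_lieE (x y : heis) : [lie x, y] = (0, omega x.1 y.1) :> heis.
Proof. by []. Qed.

Lemma dim_heis : \dim {:heis} = (\dim {:V}).+1.
Proof. by rewrite !dimvf -[LHS]/(_ + 1)%N addn1. Qed.

Lemma heis_center :
    (forall u, (forall v, omega v u = 0) -> u = 0) ->
  lie_center {:heis} = <[heis_central]>%VS.
Proof.
move=> omega_inj; apply/eqP; rewrite eqEsubv; apply/andP; split.
  apply/subvP => x /lie_centerP[_ cx]; apply/vlineP; exists x.2.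
  have x10: x.1 = 0.
    apply: omega_inj => v; have := cx (v, 0) (memvf _).
    by rewrite heis_lieE => -[].
  by rewrite [LHS]surjective_pairing x10; congr (_, _); rewrite /= ?scaler0 //
     -[RHS]/(x.2 * 1) mulr1.
rewrite -memvE; apply/lie_centerP; split=> [|u _]; first exact: memvf.
by rewrite heis_lieE /= linear0r.
Qed.

Lemma heisenberg_heis :
    (0 < \dim {:V})%N -> (forall u, (forall v, omega v u = 0) -> u = 0) ->
  heisenberg_type {:heis}.
Proof.
move=> dimV omega_inj; apply: (heisenberg_of_central_line (z := heis_central)).
- by rewrite dim_heis.
- by rewrite -[0]/(0, 0) xpair_eqE negb_and oner_eq0 orbT.
- exact: heis_center.
move=> x y _ _; apply/vlineP; exists (omega x.1 y.1).
rewrite heis_lieE; congr (_, _); rewrite /= ?scaler0 //.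
by rewrite -[RHS]/(_ * 1) mulr1.
Qed.

End Heis.

(** * The nilradical of the oscillator algebra *)

Section OscillatorTheory.
Variables (K : fieldType) (charK : [pchar K] =i pred0).
Variables (V : vectType K) (phi : {symmetric V}) (delta : 'End(V)).
Variable skew : form_skew phi delta.

Local Notation g := (oscillator charK skew).
Local Notation bdelta := (osc_delta charK skew).
Local Notation bdual := (osc_dual charK skew).
Local Notation vec := (osc_vec charK skew).
Local Notation n := (osc_heis charK skew).

Lemma osc_lieE (x y : g) :
  [lie x, y]
    = (0, x.1.1 *: delta y.1.2 - y.1.1 *: delta x.1.2, phi (delta x.1.2) y.1.2)
    :> g.
Proof. by []. Qed.

Lemma osc_decomp (x : g) : x = x.1.1 *: bdelta + (vec x.1.2 + x.2 *: bdual).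
Proof.
case: x => [[t u] s]; congr (_, _, _) => /=.
- by rewrite scaler0 !addr0 -[t%:A]/(t * 1) mulr1.
- by rewrite !scaler0 add0r addr0.
- by rewrite scaler0 !add0r -[s%:A]/(s * 1) mulr1.
Qed.

Lemma mem_osc_heis (x : g) : (x \in n) = (x.1.1 == 0).
Proof.
apply/memv_addP/eqP => [[_ /memv_imgP[u _ ->] [_ /vlineP[a ->] ->]]|x0].
  by rewrite lfunE /= scaler0 addr0.
exists (linfun vec x.1.2); first exact/memv_img/memvf.
exists (x.2 *: bdual); first by rewrite memvZ ?memv_line.
by rewrite lfunE [LHS]osc_decomp x0 scale0r add0r.
Qed.

Lemma osc_dual_neq0 : bdual != 0.
Proof. by rewrite -[0]/(0, 0, 0) !xpair_eqE /= negb_and oner_eq0 orbT. Qed.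

Lemma dim_osc_heis : \dim n = (\dim {:V}).+1.
Proof.
rewrite dimv_disjoint_sum ?dim_vline ?osc_dual_neq0 ?addn1.
  rewrite limg_dim_eq //; apply/eqP; rewrite capfv; apply/lker0P => u v.
  by rewrite !lfunE => -[].
apply/eqP; rewrite -subv0; apply/subvP => _ /memv_capP[/memv_imgP[u _ ->]].
rewrite lfunE memv0 => /vlineP[a]; case=> _ -> _.
by rewrite scaler0 linear0.
Qed.

Lemma osc_lie_heis (x y : g) : [lie x, y] \in n.
Proof. by rewrite mem_osc_heis. Qed.

Lemma osc_heis_ideal : lie_ideal n.
Proof. by apply/lie_prodP => x y _ _; exact: osc_lie_heis. Qed.

Hypothesis delta_aut : bijective delta.
Hypothesis phi_nondeg : nondegenerate phi.

Lemma delta_surj v : exists u, delta u = v.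
Proof. by have [f _ fK] := delta_aut; exists (f v). Qed.

Lemma phi_delta_inj u : (forall v, phi (delta v) u = 0) -> u = 0.
Proof.
move=> phiu; apply: (elimT (nondegenerateP phi) phi_nondeg) => w.
by have [v <-] := delta_surj w; rewrite form_symm.
Qed.

Lemma osc_center_heis : lie_center n = <[bdual]>%VS.
Proof.
apply/eqP; rewrite eqEsubv; apply/andP; split.
  apply/subvP => x /lie_centerP[]; rewrite mem_osc_heis => /eqP x0 cx.
  have u0 : x.1.2 = 0.
    apply: phi_delta_inj => v.
    have := cx (vec v); rewrite mem_osc_heis eqxx osc_lieE.
    by case/(_ isT).
  rewrite [x]osc_decomp x0 u0 scale0r linear0 !add0r.
  by rewrite memvZ ?memv_line.
rewrite -memvE; apply/lie_centerP; split; first by rewrite mem_osc_heis.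
by move=> u _; rewrite osc_lieE /= linear0 linear0r scaler0 scale0r subr0.
Qed.

Lemma heisenberg_osc_heis : (0 < \dim {:V})%N -> heisenberg_type n.
Proof.
move=> dimV; apply: (heisenberg_of_central_line (z := bdual)).
- by rewrite dim_osc_heis.
- exact: osc_dual_neq0.
- exact: osc_center_heis.
move=> x y; rewrite !mem_osc_heis => /eqP x0 /eqP y0.
rewrite osc_lieE x0 y0 !scale0r subrr; apply/vlineP.
exists (phi (delta x.1.2) y.1.2); congr (_, _, _); rewrite /= ?scaler0 //.
by rewrite -[RHS]/(_ * 1) mulr1.
Qed.

(** Reason why an ideal [I] not contained in [n] cannot be nilpotent: the
    bracket with an element [x] of [I] acts on the [V]-components of the
    elements of [n] as [x.1.1 *: delta], which is onto when [x] is not in [n]. *)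
Lemma lower_central_osc (I : {vspace g}) (x : g) k v :
  lie_ideal I -> x \in I -> x.1.1 != 0 ->
  exists2 y : g, y \in lower_central I k & y.1 = (0, v).
Proof.
move=> /lie_prodP idI Ix x0; elim: k v => [|k IH] v.
  (* At the start only one argument of the bracket has to lie in I. *)
  have [w wv] := delta_surj (- (x.1.1^-1 *: v)).
  exists [lie vec w, x]; first by apply: idI => //; rewrite memvf.
  rewrite osc_lieE /= wv; congr (_, _).
  by rewrite scale0r sub0r scalerN opprK scalerA mulfV ?scale1r.
have [w wv] := delta_surj (x.1.1^-1 *: v); have [y Iy y1] := IH w.
exists [lie x, y]; first exact: mem_lie_prod.
rewrite osc_lieE y1 /= wv; congr (_, _).
by rewrite scale0r subr0 scalerA mulfV ?scale1r.
Qed.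

Lemma osc_heis_nilradical : (0 < \dim {:V})%N -> is_nilradical n.
Proof.
move=> dimV; split; first exact: osc_heis_ideal.
  exact/heisenberg_nilpotent/heisenberg_osc_heis.
move=> I idI [k nilI]; apply/subvP => x Ix; rewrite mem_osc_heis.
apply: contraLR dimV => x0; rewrite lt0n negbK dimv_eq0 -subv0.
apply/subvP => v _; have [y] := lower_central_osc k v idI Ix x0.
by rewrite nilI !memv0 => /eqP-> [<-].
Qed.

(** * Derivations of the oscillator algebra *)

(** A description of [n] from which its invariance under all derivations is
    immediate: [V] is the image of [ad bdelta] because [delta] is onto, and
    [bdual] spans the derived algebra of [n]. *)
Lemma osc_heisE : (0 < \dim {:V})%N -> n = lie_prod {:g} {:g}.
Proof.
move=> dimV; apply/eqP; rewrite eqEsubv; apply/andP; split; last first.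
  by apply/lie_prodP => x y _ _; exact: osc_lie_heis.
rewrite subv_add; apply/andP; split.
  apply/subvP => _ /memv_imgP[v _ ->]; have [u <-] := delta_surj v.
  have -> : linfun vec (delta u) = [lie bdelta, vec u].
    by rewrite lfunE osc_lieE /= scale1r scale0r subr0 linear0 linear0l.
  by rewrite mem_lie_prod ?memvf.
have [_ _] := heisenberg_osc_heis dimV; rewrite osc_center_heis => ->.
by apply/lie_prodP => u v _ _; rewrite mem_lie_prod ?memvf.
Qed.

Lemma osc_derivationP (D : 'End(g)) : (0 < \dim {:V})%N ->
  derivation D <->
  [/\ derivation_on n D,
      exists alpha : K, D bdual = alpha *: bdual
    & forall a : V,
        D (vec (delta a)) = [lie D bdelta, vec a] + [lie bdelta, D (vec a)]].
Proof.
move=> dimV.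
have bdelta_vec a : [lie bdelta, vec a] = vec (delta a).
  by rewrite osc_lieE /= scale1r scale0r subr0 linear0 linear0l.
have bdual_central x : [lie x, bdual] = 0.
  by rewrite osc_lieE /= linear0 linear0r scaler0 scale0r subr0.
split=> [derD | [[Dn derDn] [alpha Ddual] Dvec] x y].
  have Dn : (D @: n <= n)%VS.
    by rewrite osc_heisE // derivation_lie_prod ?subvf.
  split=> [||a]; last by rewrite -derD bdelta_vec.
    by split=> // x y _ _; apply: derD.
  apply/vlineP; have [_ _ Zn] := heisenberg_osc_heis dimV.
  have := derivation_lie_prod derD Dn Dn.
  rewrite -/(derived_algebra n) -Zn osc_center_heis => /subvP; apply.
  exact/memv_img/memv_line.
(* Only the V-component of z matters on both sides, since bdual is central and
   D maps it to a multiple of itself. *)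
have Dbd z : z \in n ->
    D [lie bdelta, z] = [lie D bdelta, z] + [lie bdelta, D z].
  rewrite mem_osc_heis => /eqP z0; rewrite [z]osc_decomp z0 scale0r add0r.
  rewrite linearDr /= linearZr_LR /= bdual_central scaler0 addr0.
  rewrite bdelta_vec Dvec !linearD /= !linearZ /= Ddual.
  rewrite !linearDr /= !linearZr_LR /=.
  by rewrite !bdual_central !scaler0 !addr0.
have split_heis (z : g) :
    exists t, exists2 w : g, w \in n & z = t *: bdelta + w.
  exists z.1.1, (vec z.1.2 + z.2 *: bdual); last exact: osc_decomp.
  by rewrite mem_osc_heis /= scaler0 addr0.
have [t [u nu ->]] := split_heis x; have [t' [v nv ->]] := split_heis y.
have Dbd' z : z \in n ->
    D [lie z, bdelta] = [lie D z, bdelta] + [lie z, D bdelta].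
  move=> nz; rewrite lieC linearN /= Dbd // opprD addrC.
  by rewrite [[lie D z, _]]lieC [[lie z, D _]]lieC.
rewrite !linearD !linearZ /=.
rewrite !linearDl /= !linearDr /= !linearZl_LR /= !linearZr_LR /=.
rewrite lie_alt !scaler0 add0r !linearD !linearZ /= Dbd // Dbd' // derDn //.
have -> : [lie D bdelta, bdelta] = - [lie bdelta, D bdelta] by rewrite lieC.
apply: coord_inj => i; rewrite !(linearD, linearN, linearZ) /=; ring.
Qed.

(** * The oscillator algebra as a split extension *)

(** The bracket of two vectors of [V] is [osc_form u v *: bdual]. *)
Definition osc_form u v := phi (delta u) v.

Lemma osc_form_bilinear : bilinear_for *%R *%R osc_form.
Proof.
split=> [v a u1 u2 | u a v1 v2]; rewrite /osc_form.
  by rewrite linearP linearPl.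
by rewrite linearPr.
Qed.

HB.instance Definition _ :=
  bilinear_isBilinear.Build K V V K *%R *%R osc_form osc_form_bilinear.

Lemma osc_form_alt u : osc_form u u = 0.
Proof. by case: (osc_lie_alt (vec u)). Qed.

Local Notation h := (heis osc_form_alt).

Definition heis_delta (x : h) : h := (delta x.1, 0).

Lemma heis_delta_linear : linear heis_delta.
Proof.
by move=> a x y; congr (_, _); rewrite /= ?linearP // scaler0 addr0.
Qed.

HB.instance Definition _ :=
  GRing.isLinear.Build K h h *:%R heis_delta heis_delta_linear.

Local Notation imd := (limg (linfun heis_delta)).
Local Notation kerd := (lker (linfun heis_delta)).

Lemma heis_deltaE x : linfun heis_delta x = (delta x.1, 0) :> h.
Proof. by rewrite lfunE. Qed.

(** All brackets of [h] are killed by [heis_delta], so this is the skewness of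
    [delta] for [osc_form], which follows from that for [phi]. *)
Lemma heis_delta_derivation : derivation (linfun heis_delta).
Proof.
move=> x y; rewrite !lfunE !heis_lieE /=; congr (_, _).
  by rewrite /= linear0 addr0.
by rewrite /osc_form /= form_skewE // addNr.
Qed.

Lemma mem_limg_heis_delta (x : h) : (x \in imd) = (x.2 == 0).
Proof.
apply/memv_imgP/eqP => [[y _ ->]|x20]; first by rewrite lfunE.
have [u ux] := delta_surj x.1; exists (u, 0); first exact: memvf.
by rewrite heis_deltaE /= ux -x20 -surjective_pairing.
Qed.

Lemma mem_lker_heis_delta (x : h) : (x \in kerd) = (x.1 == 0).
Proof.
rewrite memv_ker heis_deltaE -[0 : h]/(0, 0) xpair_eqE eqxx andbT.
by rewrite -{1}[0](linear0 delta) (inj_eq (bij_inj delta_aut)).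
Qed.

Lemma lker_heis_delta : kerd = lie_center {:h}.
Proof.
rewrite heis_center; last exact: phi_delta_inj.
apply/vspaceP => x; rewrite mem_lker_heis_delta.
apply/eqP/vlineP => [x10|[a ->]].
  exists x.2; rewrite [LHS]surjective_pairing x10; congr (_, _).
    by rewrite /= scaler0.
  by rewrite -[RHS]/(x.2 * 1) mulr1.
exact: scaler0.
Qed.

Lemma directv_heis_delta : directv (imd + kerd).
Proof.
apply/directv_addP/eqP; rewrite -subv0; apply/subvP => x /memv_capP[].
rewrite mem_limg_heis_delta mem_lker_heis_delta memv0 => /eqP x2 /eqP x1.
by rewrite [x]surjective_pairing x1 x2.
Qed.

Lemma addv_heis_delta : (imd + kerd)%VS = {:h}%VS.
Proof.
apply/eqP; rewrite eqEsubv subvf /=; apply/subvP => x _.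
have -> : x = (x.1, 0) + (0, x.2) :> h.
  by rewrite [LHS]surjective_pairing; congr (_, _); rewrite /= ?addr0 ?add0r.
by apply: memv_add; rewrite (mem_limg_heis_delta, mem_lker_heis_delta).
Qed.

Definition heis_form (x y : subvs_of imd) := phi (vsval x).1 (vsval y).1.

Lemma heis_form_bilinear : bilinear_for *%R (idfun \; *%R) heis_form.
Proof.
split=> [y a x1 x2 | x a y1 y2]; rewrite /heis_form.
  by rewrite linearP linearPl.
by rewrite [vsval (_ + _)]linearP linearPr.
Qed.

HB.instance Definition _ :=
  bilinear_isBilinear.Build K (subvs_of imd) (subvs_of imd) K
    *%R (idfun \; *%R) heis_form heis_form_bilinear.

Lemma heis_form_sym x y : heis_form x y = (-1) ^+ false * idfun (heis_form y x).
Proof. exact: hermC. Qed.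

HB.instance Definition _ :=
  isHermitianSesquilinear.Build K (subvs_of imd) false idfun heis_form
    heis_form_sym.

Lemma heis_form_nondeg : nondegenerate heis_form.
Proof.
apply/nondegenerateP => x phix; apply/val_inj.
have /eqP x2 : (vsval x).2 == 0 by rewrite -mem_limg_heis_delta subvsP.
suff x1 : (vsval x).1 = 0 by rewrite [LHS]surjective_pairing x1 x2.
apply: (elimT (nondegenerateP phi) phi_nondeg) => v.
have v_im : ((v, 0) : h) \in imd by rewrite mem_limg_heis_delta.
by have := phix (vsproj _ (v, 0)); rewrite /= /heis_form vsprojK.
Qed.

Lemma heis_form_skew :
  form_skew heis_form (restr (linfun heis_delta) (U := imd)).
Proof.
move=> x y; rewrite /= /heis_form /restr !vsprojK ?memv_img ?memvf //.
by rewrite !lfunE; apply: skew.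
Qed.

Local Notation ext := (split_ext heis_delta_derivation).

Definition osc_ext (x : g) : ext := (x.1.1, (x.1.2, x.2)).

Lemma osc_ext_linear : linear osc_ext.
Proof. by []. Qed.

HB.instance Definition _ :=
  GRing.isLinear.Build K g ext *:%R osc_ext osc_ext_linear.

Lemma osc_ext_isomorphic : lie_isomorphic g ext.
Proof.
exists (linfun osc_ext) => [|x y].
  exists (fun y : ext => (y.1, y.2.1, y.2.2) : g) => [x|y].
    by rewrite lfunE; case: x => [[]].
  by rewrite lfunE; case: y => ? [].
rewrite !lfunE /=; congr (_, (_, _)) => /=.
  by rewrite !lfunE /= addr0.
by rewrite !lfunE /= !scaler0 subr0 add0r.
Qed.

Lemma osc_split_ext : (0 < \dim {:V})%N ->
  exists (h : lieAlgType K) (d : 'End(h)) (der_d : derivation d),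
    [/\ \dim {:h} = (\dim {:V}).+1 /\ heisenberg_type {:h},
        directv (limg d + lker d) /\ (limg d + lker d)%VS = {:h}%VS,
        lker d = lie_center {:h},
        (d @: limg d <= limg d)%VS /\
        (exists2 psi : {symmetric (subvs_of (limg d))},
           nondegenerate psi & form_skew psi (restr d (U := limg d)))
      & lie_isomorphic g (split_ext der_d)].
Proof.
move=> dimV; exists h, (linfun heis_delta), heis_delta_derivation; split.
- split; first exact: dim_heis.
  exact: (heisenberg_heis osc_form_alt dimV phi_delta_inj).
- by split; [apply: directv_heis_delta | apply: addv_heis_delta].
- exact: lker_heis_delta.
- split; first by rewrite limgS ?subvf.
  by exists heis_form; [apply: heis_form_nondeg | apply: heis_form_skew].
- exact: osc_ext_isomorphic.
Qed.

End OscillatorTheory.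

Theorem proposition4 (K : fieldType) (charK : [pchar K] =i pred0)
    (m : nat) (m_gt0 : (0 < m)%N)
    (V : vectType K) (dimV : \dim {:V} = (2 * m)%N)
    (phi : {symmetric V}) (phi_nondeg : nondegenerate phi)
    (delta : 'End(V)) (delta_aut : bijective delta)
    (delta_skew : form_skew phi delta) :
  let g : lieAlgType K := oscillator charK delta_skew in
  let bdelta : g := osc_delta charK delta_skew in
  let bdual : g := osc_dual charK delta_skew in
  let vec : V -> g := osc_vec charK delta_skew in
  let n : {vspace g} := osc_heis charK delta_skew in
  (exists (h : lieAlgType K) (d : 'End(h)) (der_d : derivation d),
    [/\ \dim {:h} = (2 * m).+1 /\ heisenberg_type {:h},
        directv (limg d + lker d) /\ (limg d + lker d)%VS = {:h}%VS,
        lker d = lie_center {:h},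
        (d @: limg d <= limg d)%VS /\
        (exists2 psi : {symmetric (subvs_of (limg d))},
           nondegenerate psi & form_skew psi (restr d (U := limg d)))
      & lie_isomorphic g (split_ext der_d)])
  /\ [/\ is_nilradical n, \dim n = (2 * m).+1 & heisenberg_type n]
  /\ (forall D : 'End(g),
        derivation D <->
        [/\ derivation_on n D,
            exists alpha : K, D bdual = alpha *: bdual
          & forall a : V,
              D (vec (delta a))
              = [lie D bdelta, vec a] + [lie bdelta, D (vec a)]]).
Proof.
move=> g bdelta bdual vec n.
have dimV_gt0 : (0 < \dim {:V})%N by rewrite dimV muln_gt0.
rewrite -dimV; split; last split.
- exact: osc_split_ext.
- split; [exact: osc_heis_nilradical | | exact: heisenberg_osc_heis].
  exact: dim_osc_heis.
- by move=> D; apply: osc_derivationP.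
Qed.
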